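(* Every $A_2$-set of real numbers has property ${\sf S}_1(\Gamma,\Gamma)$.
   Context: A set $X$ of reals is an $A_2$-set if for every Borel function $\Psi:X\to\omega^\omega$ the image $\Psi[X]$ is bounded, i.e., some $g\in\omega^\omega$ eventually dominates every element of $\Psi[X]$. ''Cover'' means countable open cover. A cover of $X$ is a $\gamma$-cover if it is infinite and each point of $X$ fails to belong to only finitely many members. $X$ has ${\sf S}_1(\Gamma,\Gamma)$ if for every sequence $(\mathcal{U}_n)$ of $\gamma$-covers of $X$ one can choose $U_n\in\mathcal{U}_n$ such that $\{U_n:n\in\omega\}$ is a $\gamma$-cover of $X$. *)

(* Defs.v *)
From HB Require Import structures.
From mathcomp Require Import all_boot all_order all_algebra.
From mathcomp Require Import all_classical all_reals all_analysis.

Set Implicit Arguments.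
Unset Strict Implicit.
Unset Printing Implicit Defensive.

Import Order.TTheory GRing.Theory Num.Theory.
Import numFieldNormedType.Exports.

Local Open Scope classical_set_scope.

(* omega^omega with the product topology; the topology of [nat] is discrete. *)
Definition baire_space : topologicalType := {ptws nat -> nat}.

(* [g_sigma_algebraType] would need pointed types, which excludes the empty
   set of reals, so the Borel sigma-algebra is written [<<s open >>]. *)
Definition borel_function (S T : topologicalType) (f : S -> T) : Prop :=
  forall B : set T, <<s open >> B -> <<s open >> (f @^-1` B).

Definition eventually_dominates (g f : nat -> nat) : Prop :=
  \forall n \near \oo, (f n <= g n)%N.

Definition bounded_family (F : set baire_space) : Prop :=
  exists g : baire_space, forall f, F f -> eventually_dominates g f.

(* A set of reals as a space, with the subspace topology. *)
Definition space_of (R : realType) (X : set R) : topologicalType := set_type X.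

Definition A2_set (R : realType) (X : set R) : Prop :=
  forall Psi : space_of X -> baire_space, borel_function Psi ->
    bounded_family (range Psi).

Definition countable_open_cover (T : topologicalType) (U : set (set T)) : Prop :=
  [/\ countable U, U `<=` open & cover U id = [set: T]].

Definition gamma_cover (T : topologicalType) (U : set (set T)) : Prop :=
  [/\ countable_open_cover U, infinite_set U &
      forall x : T, finite_set [set V | U V /\ ~ V x]].

(* The selected members form the family [range V]: repetitions in the sequence
   are not counted, and the family itself has to satisfy [B]. *)
Definition S1 (T : Type) (A B : set (set (set T))) : Prop :=
  forall U : nat -> set (set T), (forall n, A (U n)) ->
    exists2 V : nat -> set T, (forall n, U n (V n)) & B (range V).

Definition S1_Gamma_Gamma (T : topologicalType) : Prop :=
  S1 (@gamma_cover T) (@gamma_cover T).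

(* Main.v *)
Require Import Defs.
From mathcomp Require Import all_boot all_order all_algebra.
From mathcomp Require Import all_classical all_reals all_analysis.
Local Open Scope classical_set_scope.

(** Enumerate the [n]-th gamma-cover injectively as [e n 0, e n 1, ...] and let
    [Psi x n] be the least [m] such that [x] lies in [e n k] for all [k >= m].
    The set where [Psi x n <= m] is a countable intersection of open sets, so
    [Psi] is Borel and its range is bounded by some [g]. Any selection
    [e n (h n)] with [h >= g] then contains each point for almost all [n];
    choosing [h] so that the selected members are pairwise distinct makes the
    selected family infinite. *)

Section SigmaAlgebra.
Context {T : Type} {M : set (set T)} (sM : sigma_algebra [set: T] M).

Lemma sigma_algebra_set0 : M set0. Proof. by case: sM. Qed.

Lemma sigma_algebra_setC A : M A -> M (~` A).
Proof. by rewrite -setTD; case: sM => _ + _; apply. Qed.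

Lemma sigma_algebra_setT : M setT.
Proof.
by rewrite -setC0; apply: sigma_algebra_setC; exact: sigma_algebra_set0.
Qed.

Lemma sigma_algebra_cup (F : nat -> set T) :
  (forall i, M (F i)) -> M (\bigcup_i F i).
Proof. by case: sM => _ _; apply. Qed.

Lemma sigma_algebra_cap (F : nat -> set T) :
  (forall i, M (F i)) -> M (\bigcap_i F i).
Proof.
move=> MF; rewrite -[X in M X]setCK setC_bigcap.
apply: sigma_algebra_setC; apply: sigma_algebra_cup => i.
exact: sigma_algebra_setC.
Qed.

Lemma sigma_algebra_setI A B : M A -> M B -> M (A `&` B).
Proof.
move=> MA MB; rewrite -bigcap2E; apply: sigma_algebra_cap => -[|[|i]] //=.
exact: sigma_algebra_setT.
Qed.

End SigmaAlgebra.

(** Coding basic open sets by finite sequences makes them countably many, so that every open set is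
    a countable union of them. *)
Definition cylinder (s : seq nat) : set baire_space :=
  [set f | forall i, (i < size s)%N -> f i = nth 0%N s i].

(** By contradiction: otherwise each [n] yields a point outside [O] that agrees with [f] below
    [n]. *)
Lemma open_baire_cylinder (O : set baire_space) (f : baire_space) :
  open O -> O f -> exists s : seq nat, cylinder s f /\ cylinder s `<=` O.
Proof.
move=> oO Of.
have [//|nO] := pselect (exists s, cylinder s f /\ cylinder s `<=` O).
have /choice[u u_] : forall n, exists g : baire_space,
    (forall i, (i < n)%N -> g i = f i) /\ ~ O g.
  move=> n; apply: contrapT => /forallNP nu; apply: nO.
  exists (mkseq f n); split=> [i|g gf].
    by rewrite size_mkseq => ?; rewrite nth_mkseq.
  apply: contrapT => nOg; apply: (nu g); split => // i ilt.
  by rewrite gf ?size_mkseq// nth_mkseq.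
(* Such [u n] converge to [f] pointwise, so they eventually enter [O]. *)
have cu : u @ \oo --> (f : baire_space).
  apply/cvg_sup => i; apply/cvg_image.
    by apply/seteqP; split => // k _; exists (fun=> k).
  move=> A /= Af; exists [set g : nat -> nat | A (g i)].
    exists i.+1 => // n /= ilt; rewrite (u_ n).1//; exact: nbhs_singleton Af.
  by apply/seteqP; split => [k [g Ag <-]//|k Ak]; exists (fun=> k).
have [N _ /(_ N (leqnn N))] : \forall n \near \oo, O (u n).
  by apply: cu; exact: open_nbhs_nbhs.
by case: (u_ N).
Qed.

(** Differences of consecutive sublevel sets give the level sets of each coordinate; countable
    intersections of these give preimages of cylinders, and countable unions give preimages of open
    sets. *)
Lemma sigma_algebra_preimage_open (S : Type) (M : set (set S))
    (f : S -> baire_space) :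
  sigma_algebra [set: S] M -> (forall n k, M [set x | (f x n <= k)%N]) ->
  forall O, open O -> M (f @^-1` O).
Proof.
move=> sM fle O oO.
have feq n k : M [set x | f x n = k].
  case: k => [|k].
    rewrite (_ : mkset _ = [set x | (f x n <= 0)%N])//.
    by apply/seteqP; split => x /=; [move->|rewrite leqn0 => /eqP].
  rewrite (_ : mkset _ =
      [set x | (f x n <= k.+1)%N] `&` ~` [set x | (f x n <= k)%N]).
    by apply: (sigma_algebra_setI sM) => //; apply: (sigma_algebra_setC sM).
  apply/seteqP; split => x /= => [->|[le1 /negP]]; first by rewrite leqnn ltnn.
  by rewrite -ltnNge => lt1; apply/eqP; rewrite eqn_leq le1.
have fcyl s : M (f @^-1` cylinder s).
  rewrite (_ : _ @^-1` _ = \bigcap_i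
      [set x | (i < size s)%N -> f x i = nth 0%N s i]); last first.
    by apply/seteqP; split => [x xs i _|x xs i] /=; [exact: xs|exact: xs].
  (* Indices beyond the length of [s] impose no condition and contribute the whole space. *)
  apply: (sigma_algebra_cap sM) => i; case: (ltnP i (size s)) => [ilt|ige].
    rewrite (_ : mkset _ = [set x | f x i = nth 0%N s i])//.
    by apply/seteqP; split => x /=; [apply|].
  rewrite (_ : mkset _ = setT); first exact: (sigma_algebra_setT sM).
  by apply/seteqP; split.
(* The union is to range over all of [nat] through [unpickle]; codes of no sequence, and cylinders
   not inside [O], contribute the empty set. *)
pose C (o : option (seq nat)) :=
  if o is Some s then [set g | cylinder s g /\ cylinder s `<=` O] else set0.
have fC o : M (f @^-1` C o).
  case: o => [s|]; last by rewrite preimage_set0; apply: (sigma_algebra_set0 sM).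
  have [sO|nsO] := pselect (cylinder s `<=` O).
    by rewrite (_ : C _ = cylinder s)//; apply/seteqP; split => g //= [].
  rewrite (_ : C _ = set0); last by apply/seteqP; split => g //= -[].
  by rewrite preimage_set0; apply: (sigma_algebra_set0 sM).
rewrite (_ : O = \bigcup_i C (unpickle i)).
  by rewrite preimage_bigcup; apply: (sigma_algebra_cup sM) => i.
apply/seteqP; split => [g Og|g [i _]].
  have [s sO] := open_baire_cylinder O g oO Og.
  by exists (pickle s) => //; rewrite pickleK.
by case: (unpickle i) => //= s [gs]; apply.
Qed.

(** The sets with Borel preimage form a sigma-algebra, so it suffices that it contains the open
    sets. *)
Lemma borel_function_baire (S : topologicalType) (f : S -> baire_space) :
  (forall n k, <<s open >> [set x | (f x n <= k)%N]) -> borel_function f.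
Proof.
have := smallest_sigma_algebra [set: S] open; rewrite /borel_function.
move: <<s open >> => M sM fle.
suff: <<s open >> `<=` image_set_system [set: S] f M.
  by move=> sub B /sub; rewrite /image_set_system/= setTI.
apply: smallest_sub => [|O oO]; first exact: sigma_algebra_image.
rewrite /image_set_system/= setTI.
exact: sigma_algebra_preimage_open sM fle O oO.
Qed.

Lemma countable_infinite_enum (T : pointedType) (A : set T) :
  countable A -> infinite_set A ->
  exists2 e : nat -> T, injective e & range e = A.
Proof.
move=> cA iA.
have /card_set_bijP[e [fun_e inj_e surj_e]] : ([set: nat] #= A)%card.
  by rewrite card_eq_sym; apply: eq_card_nat.
exists e; first by move=> x y; apply: inj_e; rewrite inE.
by apply/seteqP; split => // _ [x _ <-]; apply: fun_e.
Qed.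

(** Choose recursively: at stage [n] only finitely many values are already taken, while the
    injective [W n] has infinitely many values at indices above [g n]. *)
Lemma injective_diagonal (T : Type) (W : nat -> nat -> T) (g : nat -> nat) :
  (forall n, injective (W n)) ->
  exists2 h : nat -> nat, (forall n, g n <= h n)%N &
    injective (fun n => W n (h n)).
Proof.
(* Classical decidable equality on [T] allows membership in finite sequences of values. *)
pose W' n k : {classic T} := W n k.
move=> injW.
have /choice[F F_] : forall ns : nat * seq {classic T}, exists k,
    (g ns.1 <= k)%N /\ W' ns.1 k \notin ns.2.
  move=> [n s] /=; apply: contrapT => /forallNP ns.
  pose t := [seq W' n k | k <- iota (g n) (size s).+1].
  (* Otherwise all [size s + 1] distinct members of [t] would lie in [s]. *)
  have : (size t <= size s)%N.
    apply: uniq_leq_size => [|_ /mapP[k + ->]].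
      by rewrite map_inj_uniq ?iota_uniq//; exact: injW.
    rewrite mem_iota => /andP[gk _]; apply/negPn/negP => nk.
    exact: (ns k).
  by rewrite size_map size_iota ltnn.
(* [s n] lists the values selected at the stages before [n]. *)
pose s := fix s n := if n is m.+1 then W' m (F (m, s m)) :: s m else [::].
pose h n := F (n, s n).
have hs m n : (m < n)%N -> W' m (h m) \in s n.
  elim: n => // n IHn; rewrite ltnS leq_eqVlt inE => /predU1P[->|/IHn ->].
    by rewrite eqxx.
  by rewrite orbT.
have hneq m n : (m < n)%N -> W m (h m) <> W n (h n).
  move=> mn eqW; have := hs _ _ mn; rewrite [W' m _]eqW.
  by apply/negP; exact: (F_ (n, s n)).2.
exists h => [n|m n eqW]; first exact: (F_ (n, s n)).1.
by case: (ltngtP m n) => // /hneq; rewrite eqW.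
Qed.

Lemma finite_set_nat_bounded (A : set nat) :
  finite_set A -> exists m, forall k, (m <= k)%N -> ~ A k.
Proof.
move=> /finite_seqP[B ->]; exists (\max_(i <- B) i).+1 => k mk /= kB.
by have := @leq_bigmax_seq _ B xpredT id k kB isT; rewrite leqNgt mk.
Qed.

Theorem mainTheorem18 (R : realType) (X : set R) (hX : A2_set X) :
  S1_Gamma_Gamma (space_of X).
Proof.
move=> U gU.
have /choice[e e_] : forall n, exists e : nat -> set (space_of X),
    injective e /\ range e = U n.
  move=> n; have [[cU _ _] iU _] := gU n.
  by have [e] := countable_infinite_enum _ _ cU iU; exists e.
have Ue n k : U n (e n k) by rewrite -(e_ n).2.
have oe n k : open (e n k) by have [[_ oU _] _ _] := gU n; exact: oU.
(* Minimality of [Psi x n] is recorded as an equivalence, which describes its sublevel sets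
   directly. *)
have /choice[Psi Psi_] : forall x, exists f : baire_space,
    forall n k, (f n <= k)%N <-> forall j, (k <= j)%N -> e n j x.
  move=> x; suff /choice[f fP] : forall n, exists m, forall k,
      (m <= k)%N <-> forall j, (k <= j)%N -> e n j x by exists f.
  move=> n.
  have exm : exists m, `[< forall j, (m <= j)%N -> e n j x >].
    have [_ _ /(_ x) finx] := gU n.
    have [m nm] : exists m, forall k, (m <= k)%N -> ~ [set j | ~ e n j x] k.
      (* Since [e n] is injective, the finitely many members missing [x] occupy only finitely many
         indices. *)
      apply: finite_set_nat_bounded.
      apply: sub_finite_set (finite_preimage (f := e n) _ finx) => [j|i j _ _].
        by split.
      exact: (e_ n).1.
    by exists m; apply/asboolP => j /nm /contrapT.
  exists (ex_minn exm) => k; case: ex_minnP => m /asboolP me minm.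
  split=> [mk j kj|ke]; first exact/me/(leq_trans mk).
  by apply: minm; apply/asboolP.
have [|g Psig] := hX Psi.
  apply: borel_function_baire => n k.
  have sM := smallest_sigma_algebra [set: space_of X] open.
  rewrite (_ : mkset _ = \bigcap_j e n (k + j)%N).
    by apply: (sigma_algebra_cap sM) => j; exact: sub_sigma_algebra.
  apply/seteqP; split => x /=.
    by move=> /Psi_ xe j _; apply: xe; exact: leq_addr.
  by move=> xe; apply/Psi_ => j kj; rewrite -(subnKC kj); exact: xe.
have [h gh injh] := injective_diagonal _ e g (fun n => (e_ n).1).
exists (fun n => e n (h n)) => //.
have Vx x : exists N, forall n, (N <= n)%N -> e n (h n) x.
  have [|N _ NP] := Psig (Psi x); first by exists x.
  (* For [n >= N], [Psi x n <= g n], so [x] lies in [e n j] for every [j >= g n], in particular for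
     [j = h n]. *)
  exists N => n /NP fg; exact: (iffLR (Psi_ x n (g n))).
split.
- split.
  + exact: card_image_le.
  + by move=> _ [n _ <-].
  + apply/seteqP; split => // x _; have [N xN] := Vx x.
    by exists (e N (h N)); [exists N|exact: xN].
(* By injectivity of the selection, a finite range would make [nat] finite. *)
- move=> /(finite_preimage (f := fun n => e n (h n))) fin.
  apply: infinite_nat; apply: sub_finite_set (fin _) => [n _|m n _ _].
    by exists n.
  exact: injh.
- move=> x; have [N xN] := Vx x.
  (* A selected member that misses [x] has its index below [N]. *)
  apply: (sub_finite_set _ (finite_image (fun n => e n (h n)) (finite_II N))).
  move=> _ [[n _ <-] nx]; exists n => //=.
  by rewrite ltnNge; apply/negP => /xN.
Qed.
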